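(* Let $G$ be a finite group with $|G|>1$. For each integer $m\ge 0$ let $N_G(m)=|\{x\in G:\operatorname{ord}(x)>m\}|$. Then $$\mathcal{C}(G)=\max\{m\in\mathbb{N}:N_G(m)\ge m\}.$$ Moreover, for each integer $m\ge 1$, the number of Chowla sets of $G$ of cardinality $m$ is $$\binom{N_G(m)}{m}.$$
   Context: For an element $x$ of a finite group $G$, $\operatorname{ord}(x)$ denotes its order. A nonempty subset $S\subseteq G$ is called a Chowla set if $\operatorname{ord}(x)>|S|$ for every $x\in S$. Define $\mathcal{C}(G)=\max\{|S|:S\subseteq G\text{ is a Chowla set}\}$. *)

(* Defs.v *)
From HB Require Import structures.
From mathcomp Require Import all_boot all_fingroup.

Set Implicit Arguments.
Unset Strict Implicit.
Unset Printing Implicit Defensive.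

Local Open Scope group_scope.

Definition chowla_set (gT : finGroupType) (G S : {set gT}) : bool :=
  [&& S \subset G, S != set0 & [forall x in S, #|S| < #[x]]].

(* The maximum over an empty family is 0; the family of Chowla sets is
   nonempty as soon as G is a nontrivial group (any [set x] with x != 1). *)
Definition chowla_number (gT : finGroupType) (G : {set gT}) : nat :=
  \max_(S : {set gT} | chowla_set G S) #|S|.

Definition num_order_gt (gT : finGroupType) (G : {set gT}) (m : nat) : nat :=
  #|[set x in G | m < #[x]]|.

(* "n = max {m : nat | P m}", including that the maximum exists. *)
Definition is_max_nat (P : nat -> Prop) (n : nat) : Prop :=
  P n /\ forall m : nat, P m -> m <= n.

(* Main.v *)
Require Import Defs.
From HB Require Import structures.
From mathcomp Require Import all_boot all_fingroup.

(** Once the cardinality [m >= 1] of [S] is fixed, the Chowla condition no longer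
    couples the elements of [S]: it only asks that each of them have order
    greater than [m].  Hence the Chowla sets of cardinality [m] are exactly the
    [m]-subsets of [[set x in G | m < #[x]]] ([chowla_setE]), and counting them
    gives the binomial coefficient ([card_chowla_sets]).  That coefficient is
    positive exactly when [m <= num_order_gt G m], so the inequality
    characterises the positive cardinalities of Chowla sets, and the Chowla
    number is the largest of them. *)

Lemma chowla_setE (gT : finGroupType) (G S : {set gT}) :
  chowla_set G S = (S != set0) && (S \subset [set x in G | #|S| < #[x]%g]).
Proof.
rewrite /chowla_set andbCA; congr (_ && _).
apply/andP/subsetP => [[/subsetP sSG /forall_inP ordS] x Sx | sSH].
  by rewrite inE sSG ?ordS.
by split; [apply/subsetP | apply/forall_inP] => x /sSH; rewrite inE => /andP[].
Qed.

Lemma card_chowla_sets (gT : finGroupType) (G : {set gT}) (m : nat) :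
  0 < m ->
  #|[set S : {set gT} | chowla_set G S & #|S| == m]| = 'C(num_order_gt G m, m).
Proof.
move=> m_gt0; rewrite -cards_draws; apply: eq_card => S; rewrite !inE chowla_setE.
case: (#|S| =P m) => [cardS | _]; last by rewrite !andbF.
by rewrite -card_gt0 cardS m_gt0.
Qed.

Lemma chowla_set_card_le (gT : finGroupType) (G S : {set gT}) :
  chowla_set G S -> #|S| <= num_order_gt G #|S|.
Proof. by rewrite chowla_setE => /andP[_ /subset_leq_card]. Qed.

Lemma chowla_set_of_card (gT : finGroupType) (G : {set gT}) (m : nat) :
  0 < m <= num_order_gt G m -> exists2 S, chowla_set G S & #|S| = m.
Proof.
case/andP=> m_gt0; rewrite -bin_gt0 -(card_chowla_sets gT G m m_gt0).
by case/card_gt0P=> S; rewrite inE => /andP[chS /eqP cardS]; exists S.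
Qed.

Lemma chowla_number_is_max (gT : finGroupType) (G : {set gT}) :
  is_max_nat (fun m : nat => m <= num_order_gt G m) (chowla_number G).
Proof.
split=> [|[//|m] le_mN].
  (* The property holds for 0 and for each Chowla cardinality, and the larger
     of two numbers is one of them, so it passes to the maximum. *)
  apply: (big_ind (fun m => m <= num_order_gt G m)) => // [m n Pm Pn | S].
    by rewrite /maxn; case: ifP.
  exact: chowla_set_card_le.
have [S chS <-] : exists2 S, chowla_set G S & #|S| = m.+1.
  exact: chowla_set_of_card.
exact: leq_bigmax_cond.
Qed.

Theorem proposition2p2 (gT : finGroupType) (G : {group gT}) (hG : 1 < #|G|) :
  is_max_nat (fun m : nat => m <= num_order_gt G m) (chowla_number G) /\
  (forall m : nat, 1 <= m ->
     #|[set S : {set gT} | chowla_set G S & #|S| == m]|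
       = 'C(num_order_gt G m, m)).
Proof.
by split=> [|m]; [exact: chowla_number_is_max | exact: card_chowla_sets].
Qed.
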